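(* Suppose $\mathcal{P}$ is a hereditary property of forests (i.e. a hereditary graph property all of whose members are forests) and suppose that for every non-empty forest $F\in\mathcal{P}$ (i.e. one with at least one edge), at least one of the following holds. (i) There exists a leaf $u$ of $F$ such that any forest obtained from $F$ by replacing $u$ by an arbitrary number of (pairwise non-adjacent) twins and then adding an arbitrary number of independent (isolated) vertices lies in $\mathcal{P}$. (ii) There exist two leaves $u_1,u_2$ of $F$ adjacent to distinct vertices $v_1,v_2\in V(F)$ respectively, such that the forest obtained by replacing both $u_1$ and $u_2$ by arbitrary numbers of (pairwise non-adjacent) twins lies in $\mathcal{P}$ (for all choices of these numbers). Then $\mathcal{P}$ is uniform.
   Context: Graphs are simple and undirected. An empty graph is a graph with no edges; a non-empty graph has at least one edge. A leaf is a vertex of degree 1. Replacing a leaf $u$ by $m$ non-adjacent twins means deleting $u$ and adding $m$ pairwise non-adjacent vertices, each adjacent exactly to the neighbour of $u$. A graph property $\mathcal{P}$ is a collection of finite labelled graphs closed under isomorphism; it is hereditary if every induced subgraph of a graph in $\mathcal{P}$ is in $\mathcal{P}$. A random ordering of a finite graph $G$ is a probability distribution on the set of all total orderings of $V(G)$. A consistent random ordering model on a hereditary property $\mathcal{P}$ assigns to each $G\in\mathcal{P}$ a random ordering $\mathbb{P}_G$ of $V(G)$ such that whenever $H,G\in\mathcal{P}$ and $\phi$ is an isomorphism from $H$ onto an induced subgraph of $G$, then for all $x_1,\dots,x_k\in V(H)$, $\mathbb{P}_H(x_1<x_2<\dots<x_k)=\mathbb{P}_G(\phi(x_1)<\phi(x_2)<\dots<\phi(x_k))$.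 The uniform model takes $\mathbb{P}_G$ to be the uniform distribution on all $|V(G)|!$ orderings for each $G\in\mathcal{P}$; it is consistent. The property $\mathcal{P}$ is called uniform if the uniform model is the only consistent random ordering model on $\mathcal{P}$. *)

(* Defs.v *)
From HB Require Import structures.
From mathcomp Require Import all_boot all_order all_algebra.
From mathcomp Require Import reals.

Set Implicit Arguments.
Unset Strict Implicit.
Unset Printing Implicit Defensive.

Import Order.TTheory GRing.Theory Num.Theory.

Local Open Scope ring_scope.

Record sgraph := SGraph {
  vertex :> finType;
  edge : rel vertex;
  edge_sym : symmetric edge;
  edge_irr : irreflexive edge
}.

Arguments edge {s} x y.

Definition nonempty_graph (G : sgraph) : Prop := exists x y : G, edge x y.

Definition degree (G : sgraph) (x : G) : nat := #|[set y | edge x y]|.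

Definition is_leaf (G : sgraph) (x : G) : bool := degree x == 1%N.

(* [cycle edge] holds of [:: x; y] for every edge xy, so a graph cycle has to
   be asked to have at least three vertices. *)
Definition is_forest (G : sgraph) : Prop :=
  ~ exists s : seq G, [/\ (2 < size s)%N, uniq s & cycle edge s].

Definition is_iso (H G : sgraph) (phi : H -> G) : Prop :=
  bijective phi /\ forall x y, edge (phi x) (phi y) = edge x y.

Section Induced.
Variables (G : sgraph) (S : {set G}).

Definition induced_edge : rel {x : G | x \in S} :=
  fun x y => edge (val x) (val y).

Fact induced_sym : symmetric induced_edge.
Proof. by move=> x y; exact: edge_sym. Qed.

Fact induced_irr : irreflexive induced_edge.
Proof. by move=> x; exact: edge_irr. Qed.

Definition induced : sgraph := SGraph induced_sym induced_irr.
End Induced.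

Section ReplaceByTwins.
Variables (G : sgraph) (u : G) (m : nat).

(* [inl] are the vertices other than u, [inr] are the m twins replacing u. *)
Definition twins_edge : rel ({x : G | x != u} + 'I_m)%type :=
  fun a b => match a, b with
  | inl x, inl y => edge (val x) (val y)
  | inl x, inr _ => edge (val x) u
  | inr _, inl y => edge u (val y)
  | inr _, inr _ => false
  end.

Fact twins_sym : symmetric twins_edge.
Proof. by move=> [x|i] [y|j] //=; exact: edge_sym. Qed.

Fact twins_irr : irreflexive twins_edge.
Proof. by move=> [x|i] //=; exact: edge_irr. Qed.

Definition replace_by_twins : sgraph := SGraph twins_sym twins_irr.
End ReplaceByTwins.

Section AddIsolated.
Variables (G : sgraph) (n : nat).

Definition add_isolated_edge : rel (G + 'I_n)%type :=
  fun a b => match a, b with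
  | inl x, inl y => edge x y
  | _, _ => false
  end.

Fact add_isolated_sym : symmetric add_isolated_edge.
Proof. by move=> [x|i] [y|j] //=; exact: edge_sym. Qed.

Fact add_isolated_irr : irreflexive add_isolated_edge.
Proof. by move=> [x|i] //=; exact: edge_irr. Qed.

Definition add_isolated : sgraph := SGraph add_isolated_sym add_isolated_irr.
End AddIsolated.

Definition iso_closed (P : sgraph -> Prop) : Prop :=
  forall (H G : sgraph) (phi : H -> G), is_iso phi -> P H -> P G.

Definition hereditary (P : sgraph -> Prop) : Prop :=
  forall (G : sgraph) (S : {set G}), P G -> P (induced S).

Definition one_leaf_condition (P : sgraph -> Prop) (F : sgraph) : Prop :=
  exists u : F, is_leaf u /\
    forall m n : nat, P (add_isolated (replace_by_twins u m) n).

(* u1 is replaced first, and then the copy of u2 in the resulting graph.  If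
   {u1, u2} is a component K2 of F, the result contains K_{m1,m2}, so that such
   a pair of leaves never witnesses the condition for a property of forests. *)
Definition two_leaves_condition (P : sgraph -> Prop) (F : sgraph) : Prop :=
  exists (u1 u2 v1 v2 : F) (u21 : u2 != u1),
    [/\ is_leaf u1, is_leaf u2, edge u1 v1, edge u2 v2 & v1 != v2] /\
    forall m1 m2 : nat,
      P (@replace_by_twins (replace_by_twins u1 m1)
           (inl (exist (fun x => x != u1) u2 u21)) m2).

(* Total orderings of V, as strict orders: (x, y) \in r means x < y. *)
Definition is_torder (V : finType) (r : {set V * V}) : bool :=
  [&& [forall x, (x, x) \notin r],
      [forall x, forall y, forall z,
        ((x, y) \in r) && ((y, z) \in r) ==> ((x, z) \in r)]
    & [forall x, forall y, (x != y) ==> ((x, y) \in r) || ((y, x) \in r)]].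

Record torder (V : finType) : predArgType := TOrder {
  torder_set :> {set V * V};
  torderP : is_torder torder_set
}.

HB.instance Definition _ (V : finType) := [isSub for @torder_set V].
HB.instance Definition _ (V : finType) := [Finite of torder V by <:].

Definition tlt (V : finType) (r : torder V) : rel V :=
  fun x y => (x, y) \in torder_set r.

Record random_ordering (R : realType) (V : finType) := RandomOrdering {
  weight :> {ffun torder V -> R};
  weight_ge0 : forall r, 0 <= weight r;
  weight_sum1 : \sum_r weight r = 1
}.

(* The probability that x_1 < x_2 < ... < x_k, where xs = [:: x_1; ...; x_k] *)
Definition prob_chain (R : realType) (V : finType) (mu : random_ordering R V)
    (xs : seq V) : R :=
  \sum_(r : torder V | sorted (tlt r) xs) mu r.

Lemma card_torder_gt0 (V : finType) : (0 < #|{: torder V}|)%N.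
Proof.
pose r := [set p : V * V | (enum_rank p.1 < enum_rank p.2)%N].
suff rP : is_torder r by apply/card_gt0P; exists (TOrder rP).
apply/and3P; split.
- by apply/forallP=> x; rewrite inE ltnn.
- do 3!apply/forallP=> ?; rewrite !inE /=.
  by apply/implyP=> /andP[]; exact: ltn_trans.
- do 2!apply/forallP=> ?; rewrite !inE /=; apply/implyP=> neq.
  by rewrite -neq_ltn; apply: contra_neq neq => /val_inj/enum_rank_inj.
Qed.

Section UniformOrdering.
Variables (R : realType) (V : finType).

Definition uniform_weight : {ffun torder V -> R} :=
  [ffun=> #|{: torder V}|%:R^-1].

Fact uniform_ge0 r : 0 <= uniform_weight r.
Proof. by rewrite ffunE invr_ge0 ler0n. Qed.

Fact uniform_sum1 : \sum_r uniform_weight r = 1.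
Proof.
rewrite (eq_bigr (fun=> #|{: torder V}|%:R^-1)); last by move=> r _; rewrite ffunE.
by rewrite sumr_const -[LHS]mulr_natl mulfV // pnatr_eq0 -lt0n card_torder_gt0.
Qed.

Definition uniform_ordering : random_ordering R V :=
  RandomOrdering uniform_ge0 uniform_sum1.
End UniformOrdering.

Definition ordering_model (R : realType) (P : sgraph -> Prop) : Type :=
  forall G : sgraph, P G -> random_ordering R G.

Definition consistent (R : realType) (P : sgraph -> Prop)
    (M : ordering_model R P) : Prop :=
  forall (H G : sgraph) (hH : P H) (hG : P G)
         (S : {set G}) (phi : H -> induced S),
    is_iso phi ->
    forall xs : seq H,
      prob_chain (M H hH) xs = prob_chain (M G hG) [seq val (phi x) | x <- xs].

Definition uniform_model (R : realType) (P : sgraph -> Prop) :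
    ordering_model R P :=
  fun G _ => uniform_ordering R G.

Definition uniform_property (R : realType) (P : sgraph -> Prop) : Prop :=
  consistent (@uniform_model R P) /\
  forall M : ordering_model R P, consistent M ->
    forall (G : sgraph) (hG : P G), M G hG =1 uniform_model R hG.

(* Main.v *)
Require Import Defs.
From mathcomp Require Import all_boot all_order all_algebra.
From mathcomp Require Import reals.
From mathcomp Require Import zify ring lra.

(** Why uniformity holds.  On a graph with no edges every permutation of the
    vertices is an automorphism, so all orderings are equally likely
    ([edgeless_uniform]).  A graph [G] with an edge is compared with a graph
    [G'] on the same vertices in which a single leaf [u] has been rewired: under
    the one-leaf condition it becomes isolated, under the two-leaves condition
    it becomes a twin of the other leaf.  The point is that a consistent model orders [G] and [G'] with the
    same law ([rewire_chain]).

    To see this, let [w] be the vertex of which [u] becomes a twin.  The leaf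
    condition provides a graph of the property that contains the common part of
    [G] and [G'], together with [N] twins of [u] and [N] twins of [w].  Adding
    one of the former to the common part gives a copy of [G], adding one of the
    latter gives a copy of [G'].  So the probability of a given order of [G]
    is the expected proportion of the first sample that falls between two given
    vertices, and that of [G'] the same proportion of the second sample.  Now
    the [2N] added vertices are pairwise non-adjacent, so they are exchangeable,
    and, as for empirical distributions in the Glivenko-Cantelli theorem, both
    samples have almost equal proportions in all initial segments at once,
    however the segment is cut out by the other vertices.  A bound that holds
    uniformly over initial segments follows from a second moment computation:
    count the first sample with sign [+] and the second with sign [-]; the sum
    over an initial segment changes by one at each step, so its cube is bounded
    by the sum of the squares met on the way ([deviation_cube]), and each square
    has expectation [O(N)] ([deviation_second_moment]).  Hence the expected cube
    is [O(N ^ 2)], the proportions differ by [o(1)], and letting [N] grow gives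
    equality.

    The induction runs on the sum of a strictly increasing and strictly concave
    function of the degrees ([degree_energy]).  Isolating a leaf decreases
    it; moving a leaf from [v1] to [v2] decreases it if [v1] has the smaller
    degree, and one can choose which of the two leaves to move.  The two leaves
    are not adjacent, since otherwise their twins would span a four-cycle in a
    forest. *)

Set Implicit Arguments.
Unset Strict Implicit.
Unset Printing Implicit Defensive.

Import Order.TTheory GRing.Theory Num.Theory.
Local Open Scope ring_scope.

(** * Total orderings and chains *)

Section TotalOrderings.
Variable V : finType.
Implicit Types (r : torder V) (x y z : V) (xs ys : seq V).

Lemma tlt_irr r : irreflexive (tlt r).
Proof.
move=> x; apply/negbTE.
by have /and3P[/forallP/(_ x)] := torderP r.
Qed.

Lemma tlt_trans r : transitive (tlt r).
Proof.
move=> y x z xy yz; have /and3P[_ /forallP/(_ x)/forallP/(_ y)/forallP/(_ z) + _] := torderP r.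
by move=> /implyP; apply; apply/andP; split; [exact: xy|exact: yz].
Qed.

Lemma tlt_total r x y : x != y -> tlt r x y || tlt r y x.
Proof.
by have /and3P[_ _ /forallP/(_ x)/forallP/(_ y)/implyP] := torderP r.
Qed.

Lemma tlt_antisym r x y : tlt r x y -> tlt r y x -> False.
Proof. by move=> xy /(tlt_trans xy); rewrite tlt_irr. Qed.

Lemma tltNge r x y : x != y -> tlt r y x = ~~ tlt r x y.
Proof.
move=> neq; apply/idP/idP => [yx|]; last by case/orP: (tlt_total r neq) => ->.
by apply/negP => /(tlt_antisym yx).
Qed.

Lemma sorted_tlt_uniq r xs : sorted (tlt r) xs -> uniq xs.
Proof. exact: (sorted_uniq (@tlt_trans r) (@tlt_irr r)). Qed.

Lemma sorted_tlt_inj r xs ys :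
  sorted (tlt r) xs -> sorted (tlt r) ys -> perm_eq xs ys -> xs = ys.
Proof.
move=> sx sy; apply: (sorted_eq (@tlt_trans r)) sx sy.
by move=> x y /andP[xy /(tlt_antisym xy)].
Qed.

Lemma sort_tlt_sorted r xs :
  uniq xs -> sorted (tlt r) (sort (fun x y => (x == y) || tlt r x y) xs).
Proof.
set le := (fun x y => _) => xs_uniq.
have le_total : total le.
  rewrite /le => x y; rewrite (eq_sym y x); case: eqVneq => //= /(tlt_total r).
  by [].
have le_tr : transitive le.
  move=> y x z /predU1P[->//|xy] /predU1P[<-|yz]; apply/orP; right => //.
  exact: tlt_trans yz.
have := sort_sorted le_total xs; have: uniq (sort le xs) by rewrite sort_uniq.
rewrite (sorted_pairwise le_tr) (sorted_pairwise (@tlt_trans r)).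
rewrite uniq_pairwise => u s.
have: pairwise [rel x y | (x != y) && le x y] (sort le xs).
  by rewrite pairwise_relI u s.
by apply: sub_pairwise => x y /= /andP[/negbTE neq]; rewrite /le neq.
Qed.

(** Two elements compare in the ordering as their indices in the chain do. *)
Lemma sorted_tlt_enum_inj r s xs : (forall x, x \in xs) ->
  sorted (tlt r) xs -> sorted (tlt s) xs -> r = s.
Proof.
move=> full rs ss; apply: val_inj; apply/setP => -[x y] /=.
rewrite -[LHS]/(tlt r x y) -[RHS]/(tlt s x y).
case: (eqVneq x y) => [->|neq]; first by rewrite !tlt_irr.
have key t : sorted (tlt t) xs ->
    tlt t x y = (index x xs < index y xs)%N.
  move=> st; have lt i j : (i < j < size xs)%N -> tlt t (nth x xs i) (nth x xs j).
    move=> /andP[ij jn]; apply: (sorted_ltn_nth (@tlt_trans t)) => //.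
    exact: ltn_trans jn.
  have neqi : index x xs != index y xs.
    by apply: contra_neq neq => /(congr1 (nth x xs)); rewrite !nth_index ?full.
  case: ltngtP neqi => // ij _.
    by have := lt _ _ (introT andP (conj ij _)); rewrite !nth_index ?full ?index_mem ?full // => ->.
  apply/negbTE/negP => xy; apply: (tlt_antisym xy).
  by have := lt _ _ (introT andP (conj ij _)); rewrite !nth_index ?full ?index_mem ?full // => ->.
by rewrite !key.
Qed.

Lemma sorted_insert r (p q : seq V) x : x \notin p ->
  sorted (tlt r) (p ++ x :: q) =
  [&& sorted (tlt r) (p ++ q), ~~ has (tlt r x) p & all (tlt r x) q].
Proof.
move=> xp; rewrite !(sorted_pairwise (@tlt_trans r)) !pairwise_cat /=.
rewrite allrel_consr.
have -> : all (tlt r ^~ x) p = ~~ has (tlt r x) p.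
  rewrite -all_predC; apply: eq_in_all => y yp /=; apply: tltNge.
  by apply: contraNneq xp => ->.
by case: (allrel _ _ _); case: (pairwise _ _); case: (pairwise _ q);
   case: (has _ _); case: (all _ _).
Qed.

(** The witness fixes every element outside the list. *)
Lemma perm_eq_map_inj (xs ys : seq V) : uniq xs -> perm_eq xs ys ->
  exists2 f : V -> V, injective f & map f xs = ys.
Proof.
move=> ux pxy; have uy : uniq ys by rewrite -(perm_uniq pxy).
have sz := perm_size pxy.
exists (fun x => if x \in xs then nth x ys (index x xs) else x) => [x y|].
  case: ifP => xin; case: ifP => yin //.
  - rewrite (set_nth_default x y) ?[nth y _ _](set_nth_default x) -?sz ?index_mem //.
    move/eqP; rewrite nth_uniq -?sz ?index_mem // => /eqP.
    by move=> /(congr1 (nth x xs)); rewrite !nth_index.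
  - by move=> e; move: yin; rewrite -e (perm_mem pxy) mem_nth // -sz index_mem.
  - by move=> e; move: xin; rewrite e (perm_mem pxy) mem_nth // -sz index_mem.
case: xs => [|x0 xs'] in ux pxy sz *; first by case: ys sz {pxy uy}.
set xs := x0 :: xs' in ux pxy sz *.
apply: (@eq_from_nth _ x0); rewrite size_map // => i ilt.
rewrite (nth_map x0) // mem_nth // index_uniq //.
by apply: set_nth_default; rewrite -sz.
Qed.

End TotalOrderings.

Section Chains.
Variables (R : realType) (V : finType).
Implicit Types (mu : random_ordering R V) (xs ys : seq V).

Lemma prob_chainE mu xs :
  prob_chain mu xs = \sum_r mu r * (sorted (tlt r) xs)%:R.
Proof.
rewrite /prob_chain big_mkcond /=; apply: eq_bigr => r _.
by case: ifP; rewrite ?mulr1 ?mulr0.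
Qed.

Lemma prob_chain_ge0 mu xs : 0 <= prob_chain mu xs.
Proof. by apply: sumr_ge0 => r _; apply: weight_ge0. Qed.

Lemma prob_chain_le1 mu xs : prob_chain mu xs <= 1.
Proof.
rewrite -(weight_sum1 mu) prob_chainE; apply: ler_sum => r _.
by rewrite -[leRHS]mulr1 ler_wpM2l ?weight_ge0 // lern1 leq_b1.
Qed.

Lemma weight_chain mu r xs : (forall x, x \in xs) ->
  sorted (tlt r) xs -> mu r = prob_chain mu xs.
Proof.
move=> full rs; rewrite /prob_chain (bigD1 r) //= big1 ?addr0 // => s /andP[ss].
by rewrite (sorted_tlt_enum_inj full ss rs) eqxx.
Qed.

Lemma exists_enum_chain (r : torder V) :
  exists2 xs, perm_eq xs (enum V) & sorted (tlt r) xs.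
Proof.
eexists; last exact: (sort_tlt_sorted r (enum_uniq V)).
by rewrite perm_sort.
Qed.

Lemma constant_weight_uniform mu : (forall r s, mu r = mu s) ->
  mu =1 uniform_ordering R V.
Proof.
move=> cst r; rewrite /uniform_ordering /= ffunE.
have := weight_sum1 mu.
rewrite (eq_bigr (fun=> mu r)) // sumr_const -[_ *+ _]mulr_natl => e.
have nz : #|{: torder V}|%:R != 0 :> R by rewrite pnatr_eq0 -lt0n card_torder_gt0.
by rewrite -[LHS](mulKf nz) e mulr1.
Qed.

(** Each ordering sorts exactly one arrangement of [xs]. *)
Lemma sum_prob_permutations mu xs : uniq xs ->
  \sum_(ys <- permutations xs) prob_chain mu ys = 1.
Proof.
move=> ux; under eq_bigr do rewrite prob_chainE.
rewrite exchange_big /=; apply: etrans (weight_sum1 mu); apply: eq_bigr => r _.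
rewrite -mulr_sumr -[RHS]mulr1; congr (_ * _).
set zs := sort (fun x y => (x == y) || tlt r x y) xs.
have zs_perm : zs \in permutations xs by rewrite mem_permutations perm_sort.
have zs_sorted : sorted (tlt r) zs by apply: sort_tlt_sorted.
rewrite (bigD1_seq zs) ?permutations_uniq //= zs_sorted big_seq_cond.
rewrite [X in _ + X]big1 ?addr0 //.
move=> ys /andP[]; rewrite mem_permutations => pys neq.
case: (boolP (sorted _ _)) => // ss; case/eqP: neq.
apply: (sorted_tlt_inj ss zs_sorted).
by apply: perm_trans pys _; rewrite perm_sym perm_sort.
Qed.

End Chains.

(** * The uniform model is consistent *)

Section Relabel.
Variables (V : finType) (f : V -> V) (f_inj : injective f).

Fact relabel_subproof (r : torder V) :
  is_torder [set p : V * V | tlt r (f p.1) (f p.2)].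
Proof.
apply/and3P; split.
- by apply/forallP=> x; rewrite inE tlt_irr.
- do 3!apply/forallP=> ?; rewrite !inE /=.
  by apply/implyP=> /andP[]; apply: tlt_trans.
- do 2!apply/forallP=> ?; rewrite !inE /=; apply/implyP=> neq.
  by apply: tlt_total; rewrite inj_eq.
Qed.

Definition relabel (r : torder V) : torder V := TOrder (relabel_subproof r).

Lemma tlt_relabel r x y : tlt (relabel r) x y = tlt r (f x) (f y).
Proof. by rewrite /tlt inE. Qed.

Lemma relabel_inj : injective relabel.
Proof.
move=> r s e; apply: val_inj; apply/setP => -[x y] /=.
have [g _ gK] := injF_bij f_inj.
have := tlt_relabel r (g x) (g y); rewrite e tlt_relabel !gK.
by move=> /esym.
Qed.

Lemma sorted_relabel r xs : sorted (tlt (relabel r)) xs = sorted (tlt r) (map f xs).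
Proof.
by rewrite sorted_map; apply: eq_sorted => x y; rewrite tlt_relabel.
Qed.

End Relabel.

Section UniformModel.
Variable R : realType.

Lemma uniform_chain_map (V : finType) (f : V -> V) xs : injective f ->
  prob_chain (uniform_ordering R V) (map f xs) =
  prob_chain (uniform_ordering R V) xs.
Proof.
move=> f_inj; rewrite !prob_chainE [RHS](reindex_inj (@relabel_inj V f f_inj)).
by apply: eq_bigr => r _; rewrite sorted_relabel /= !ffunE.
Qed.

(** Relabelling makes all arrangements of [xs] equally likely. *)
Lemma uniform_chain (V : finType) (xs : seq V) :
  prob_chain (uniform_ordering R V) xs =
  if uniq xs then ((size xs)`!)%:R^-1 else 0.
Proof.
case: ifPn => [ux|nux]; last first.
  rewrite /prob_chain big_pred0 // => r; apply/negbTE.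
  by apply: contra nux => /sorted_tlt_uniq.
have := sum_prob_permutations (uniform_ordering R V) ux.
rewrite big_seq (eq_bigr (fun=> prob_chain (uniform_ordering R V) xs)); last first.
  move=> ys; rewrite mem_permutations => pys.
  have [|f f_inj <-] := @perm_eq_map_inj V xs ys ux; first by rewrite perm_sym.
  exact: uniform_chain_map.
rewrite -big_seq big_const_seq count_predT iter_addr_0 size_permutations //.
move=> e; have nz : ((size xs)`!)%:R != 0 :> R by rewrite pnatr_eq0 -lt0n fact_gt0.
by rewrite -[LHS](mulKf nz) mulr_natl e mulr1.
Qed.

Lemma uniform_consistent P : consistent (@uniform_model R P).
Proof.
move=> H G hH hG S phi [phi_bij _] xs; rewrite /uniform_model !uniform_chain.
rewrite size_map map_inj_uniq // => x y /val_inj; exact: (bij_inj phi_bij).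
Qed.

End UniformModel.

(** * Embeddings *)

Section Pullback.
Variables (H : sgraph) (V : finType) (f : V -> H).

Definition pullback_edge : rel V := fun x y => edge (f x) (f y).

Fact pullback_sym : symmetric pullback_edge.
Proof. by move=> x y; apply: edge_sym. Qed.

Fact pullback_irr : irreflexive pullback_edge.
Proof. by move=> x; apply: edge_irr. Qed.

(** No injectivity is assumed: mapping several points to one vertex makes them
    twins. *)
Definition pullback : sgraph := SGraph pullback_sym pullback_irr.
End Pullback.

Definition full_map (G H : sgraph) (f : G -> H) : Prop :=
  forall x y, edge (f x) (f y) = edge x y.

Definition embedding (G H : sgraph) (f : G -> H) : Prop :=
  injective f /\ full_map f.

Lemma embedding_iso (G H : sgraph) (f : G -> H) : embedding f ->
  exists (S : {set H}) (phi : G -> induced S),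
    is_iso phi /\ forall x, val (phi x) = f x.
Proof.
move=> [f_inj f_edge]; pose S := [set f x | x in G].
have fS x : f x \in S by rewrite imset_f.
exists S, (fun x => exist _ (f x) (fS x) : induced S); split => //.
split; last by move=> x y; exact: f_edge.
apply: inj_card_bij; first by move=> x y [/f_inj].
by rewrite card_sig -(card_imset _ f_inj); apply: subset_leq_card; apply/subsetP.
Qed.

Section Embeddings.
Variables (P : sgraph -> Prop).
Hypotheses (P_iso : iso_closed P) (P_hereditary : hereditary P).

Lemma embedding_closed (G H : sgraph) (f : G -> H) : embedding f -> P H -> P G.
Proof.
move=> /embedding_iso[S [phi [[[psi phiK psiK] phi_edge] _]]] /(@P_hereditary _ S).
apply: (@P_iso _ _ psi); split; first by exists phi.
by move=> x y; rewrite -phi_edge !psiK.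
Qed.

Variables (R : realType) (M : ordering_model R P).
Hypothesis M_cons : consistent M.

Lemma embedding_chain (G H : sgraph) (hG : P G) (hH : P H) (f : G -> H) xs :
  embedding f -> prob_chain (M hG) xs = prob_chain (M hH) (map f xs).
Proof.
move=> /embedding_iso[S [phi [phi_iso phiE]]].
rewrite (M_cons hG hH phi_iso); congr prob_chain.
by apply: eq_map => x; rewrite phiE.
Qed.

(** Both families are copies of one and the same graph, the pullback. *)
Lemma congruent_chain (V : finType) (H : sgraph) (hH : P H) (f g : V -> H) xs :
  injective f -> injective g ->
  (forall x y, edge (f x) (f y) = edge (g x) (g y)) ->
  prob_chain (M hH) (map f xs) = prob_chain (M hH) (map g xs).
Proof.
move=> f_inj g_inj fg.
have hf : P (pullback f) by apply: embedding_closed hH; split; [exact: f_inj|].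
rewrite -(@embedding_chain _ _ hf hH f); last by split; first exact: f_inj.
by rewrite (@embedding_chain _ _ hf hH g) //; split; [exact: g_inj|move=> x y; rewrite -fg].
Qed.

Lemma edgeless_uniform (G : sgraph) (hG : P G) :
  ~ nonempty_graph G -> M hG =1 uniform_model R hG.
Proof.
move=> G0; apply: constant_weight_uniform => r s.
have [xs xs_perm xs_r] := exists_enum_chain r.
have [ys ys_perm ys_s] := exists_enum_chain s.
have full zs : perm_eq zs (enum G) -> forall x, x \in zs.
  by move=> e x; rewrite (perm_mem e) mem_enum.
have [||f f_inj fE] := @perm_eq_map_inj G xs ys.
- by rewrite (perm_uniq xs_perm) enum_uniq.
- by apply: perm_trans xs_perm _; rewrite perm_sym.
rewrite (weight_chain _ (full _ xs_perm) xs_r) (weight_chain _ (full _ ys_perm) ys_s).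
rewrite -fE -{1}[xs]map_id; apply: congruent_chain => // x y.
have E0 a b : @edge G a b = false.
  by apply/negbTE/negP => ab; apply: G0; exists a, b.
by rewrite !E0.
Qed.

End Embeddings.

(** * Signed deviations of down-sets *)

Section Deviation.
Variables (R : realType) (J : finType) (sgn : J -> R) (lt : rel J).
Hypotheses (lt_irr : irreflexive lt) (lt_trans : transitive lt)
  (lt_total : forall i j, i != j -> lt i j || lt j i).
Hypothesis sgn_norm : forall j, `|sgn j| = 1.

Definition deviation (D : {set J}) : R := \sum_(j in D) sgn j.

Definition below (w : J) : {set J} := [set j | lt j w].

Definition down_closed (D : {set J}) : Prop :=
  forall i j, lt i j -> j \in D -> i \in D.

(** Removing the top element changes the deviation by at most [1], and
    [y ^ 3 <= (y - 1) ^ 3 + 3 y ^ 2] for [y >= 1]; summing up while the set is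
    emptied bounds the cube by the squares met on the way.  So a large deviation
    at one point forces many large deviations. *)
Lemma deviation_cube D : down_closed D ->
  `|deviation D| ^+ 3 <=
    3 * \sum_(w in D) (deviation (below w) + sgn w) ^+ 2.
Proof.
elim: {D}_.+1 {-2}D (ltnSn #|D|) => // n IHn D; rewrite ltnS => Dn D_down.
case: (set_0Vmem D) => [->|[w0 w0D]].
  by rewrite /deviation !big_set0 normr0 expr0n mulr0.
pose w := [arg max_(w > w0 in D) #|below w|].
have [wD w_max] : w \in D /\ forall j, j \in D -> (#|below j| <= #|below w|)%N.
  by rewrite /w; case: arg_maxnP.
have le_w j : j \in D -> j != w -> lt j w.
  move=> jD neq; case/orP: (lt_total neq) => // wj.
  have /proper_card : below w \proper below j.
    apply/properP; split; last by exists w; rewrite inE ?wj ?lt_irr.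
    by apply/subsetP => i; rewrite !inE => /lt_trans; apply.
  by rewrite ltnNge w_max.
have DwE : D :\ w = below w.
  apply/setP => j; rewrite !inE; apply/andP/idP => [[neq jD]|jw].
    exact: le_w.
  by split; [apply: contraTneq jw => ->; rewrite lt_irr | exact: D_down jw wD].
have devD : deviation D = deviation (below w) + sgn w.
  by rewrite -DwE /deviation (big_setD1 w wD) /= addrC.
have IH : `|deviation (below w)| ^+ 3 <=
    3 * \sum_(i in below w) (deviation (below i) + sgn i) ^+ 2.
  apply: IHn => [|i j ij]; last by rewrite !inE; apply: lt_trans.
  by rewrite -DwE; move: Dn; rewrite (cardsD1 w) wD.
rewrite (big_setD1 w wD) /= DwE -devD mulrDr.
have : `|deviation D| <= `|deviation (below w)| + 1.
  by rewrite devD -(sgn_norm w) ler_normD.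
rewrite -[deviation D ^+ 2]real_normK ?num_real //.
move: IH; set S := \sum_(i in _) _; move: S => S.
have := normr_ge0 (deviation D); have := normr_ge0 (deviation (below w)).
move: `|deviation D| `|deviation (below w)| => y z z0 y0 zS yz.
case: (lerP y 1) => [y1|y1]; first by nra.
have : (y - 1) ^+ 3 <= z ^+ 3 by rewrite lerXn2r ?nnegrE //; lra.
by nra.
Qed.

End Deviation.

(** * Two samples of an exchangeable family *)

Section TwoSamples.
Variables (R : realType) (V : finType) (mu : random_ordering R V).
Variables (N : nat) (T : bool * 'I_N -> V) (c : R).
Hypothesis T_inj : injective T.
Hypothesis triples : forall t s w, uniq [:: t; s; w] ->
  prob_chain mu [:: T t; T s; T w] = c.
Hypothesis c01 : 0 <= c <= 1.

Definition sample_sign (j : bool * 'I_N) : R := if j.1 then 1 else -1.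
Definition sample_lt (r : torder V) : rel (bool * 'I_N) :=
  fun i j => tlt r (T i) (T j).

Local Notation sgn := sample_sign.
Local Notation lt := sample_lt.

Lemma sample_sign_norm j : `|sgn j| = 1.
Proof. by rewrite /sgn; case: j.1; rewrite ?normrN normr1. Qed.

Lemma sample_sign_sqr j : sgn j ^+ 2 = 1.
Proof. by rewrite /sgn; case: j.1; rewrite ?sqrrN expr1n. Qed.

Lemma sum_sample_sign : \sum_j sgn j = 0.
Proof.
rewrite -(pair_bigA _ (fun b i => sgn (b, i))) /= big_bool /sgn /=.
by rewrite !sumr_const mulNrn subrr.
Qed.

Let both_below w t s : R := \sum_r mu r * ((lt r t w)%:R * (lt r s w)%:R).

Lemma both_below_distinct w t s : uniq [:: t; s; w] -> both_below w t s = 2 * c.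
Proof.
rewrite /= !inE => /and3P[/norP[ts tw] sw _].
transitivity (prob_chain mu [:: T t; T s; T w] + prob_chain mu [:: T s; T t; T w]).
  rewrite !prob_chainE -big_split /=; apply: eq_bigr => r _.
  rewrite -mulrDr; congr (_ * _); rewrite !andbT /lt.
  have neq : T t != T s by rewrite inj_eq.
  have := tlt_total r neq; have := @tlt_antisym _ r (T t) (T s).
  have := @tlt_trans _ r (T s) (T t) (T w); have := @tlt_trans _ r (T t) (T s) (T w).
  move: (tlt r _ _) (tlt r _ _) (tlt r _ _) (tlt r _ _) => a b d e.
  by move: a b d e => [] [] [] [] h1 h2 h3 h4;
    first [by case: (h3 isT isT)|by move: (h1 isT isT)|by move: (h2 isT isT)
          |by rewrite /= ?mulr0 ?mulr1 ?addr0 ?add0r].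
by rewrite !triples /= ?inE 1?[s == t]eq_sym ?negb_or ?ts ?tw ?sw //; ring.
Qed.

Lemma both_below_bounds w t s : 0 <= both_below w t s <= 1.
Proof.
apply/andP; split.
  by apply: sumr_ge0 => r _; rewrite -natrM mulr_ge0 ?weight_ge0.
rewrite -(weight_sum1 mu); apply: ler_sum => r _.
by rewrite -natrM -[leRHS]mulr1 ler_wpM2l ?weight_ge0 // lern1; do 2!case: lt.
Qed.

Lemma both_below_irr w t s : (t == w) || (s == w) -> both_below w t s = 0.
Proof.
by move=> tsw; apply: big1 => r _; case/orP: tsw => /eqP->;
  rewrite /lt tlt_irr ?mul0r !mulr0.
Qed.

(** The probability that two distinct elements both lie below [w] does not
    depend on them; as the signs sum to zero, these terms contribute [O(1)] to
    the expanded square, and there remain at most [2N] diagonal terms. *)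
Lemma deviation_second_moment w :
  \sum_r mu r * deviation sgn (below (lt r) w) ^+ 2 <= (2 * N + 2)%:R.
Proof.
(* the excess of the diagonal terms over the common value [2 * c] *)
pose e t := (t != w)%:R * (both_below w t t - 2 * c).
have qE t s : both_below w t s = 2 * c * ((t != w)%:R * (s != w)%:R) + (t == s)%:R * e t.
  rewrite /e; case: (eqVneq t w) => [tw|tw].
    by rewrite both_below_irr ?tw ?eqxx //= !mulr0n; ring.
  case: (eqVneq s w) => [sw|sw].
    by rewrite both_below_irr ?sw ?eqxx ?orbT //= ?(negbTE tw) /= ?mulr0n; ring.
  case: (eqVneq t s) => [->|ts] /=; first by rewrite !mulr1n; ring.
  by rewrite both_below_distinct /= ?inE ?negb_or ?ts ?tw ?sw //= ?mulr1n ?mulr0n; ring.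
have sgn_w : \sum_t sgn t * (t != w)%:R = - sgn w.
  rewrite (bigD1 w) //= eqxx mulr0 add0r; apply/eqP.
  rewrite -addr_eq0 -[X in _ == X]sum_sample_sign [X in _ == X](bigD1 w) //= addrC.
  by apply/eqP; congr (_ + _); apply: eq_bigr => t ->; rewrite mulr1.
have -> : \sum_r mu r * deviation sgn (below (lt r) w) ^+ 2 =
    \sum_t \sum_s sgn t * sgn s * both_below w t s.
  under [RHS]eq_bigr do under eq_bigr do rewrite mulr_sumr.
  under [RHS]eq_bigr do rewrite exchange_big.
  rewrite [RHS]exchange_big; apply: eq_bigr => r _ /=.
  have -> : deviation sgn (below (lt r) w) = \sum_t sgn t * (lt r t w)%:R.
    rewrite /deviation big_mkcond /=; apply: eq_bigr => t _.
    by rewrite inE; case: ifP; rewrite ?mulr1 ?mulr0.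
  rewrite expr2 mulr_suml mulr_sumr; apply: eq_bigr => t _.
  by rewrite !mulr_sumr; apply: eq_bigr => s _; ring.
have -> : \sum_t \sum_s sgn t * sgn s * both_below w t s = 2 * c + \sum_t e t.
  transitivity (2 * c * (\sum_t sgn t * (t != w)%:R) ^+ 2 + \sum_t e t); last first.
    by rewrite sgn_w sqrrN sample_sign_sqr mulr1.
  rewrite expr2 mulr_suml mulr_sumr -big_split /=; apply: eq_bigr => t _.
  rewrite !mulr_sumr (eq_bigr (fun s => 2 * c * (sgn t * (t != w)%:R *
    (sgn s * (s != w)%:R)) + (if t == s then e t else 0))); last first.
    move=> s _; rewrite qE; case: (eqVneq t s) => [->|_] /=; last by rewrite mulr0n; ring.
    rewrite mulr1n mul1r mulrDr -expr2 [in X in _ + X]sample_sign_sqr mul1r.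
    by congr (_ + _); ring.
  rewrite big_split /=; congr (_ + _).
  by rewrite -big_mkcond /= (eq_bigl (pred1 t)) ?big_pred1_eq // => s; rewrite eq_sym.
have : \sum_t e t <= \sum_(t : bool * 'I_N) 1.
  apply: ler_sum => t _; rewrite /e.
  have /andP[_ q1] := both_below_bounds w t t; have /andP[c0 _] := c01.
  by case: (t != w); rewrite /= ?mulr1n ?mulr0n ?mul1r ?mul0r; lra.
rewrite sumr_const card_prod card_bool card_ord natrD => h.
by have /andP[_ c1] := c01; lra.
Qed.

(** The down-set may depend on the ordering in any way, for instance
    be cut out by elements outside both samples: [deviation_cube] bounds all
    down-sets at once. *)
Lemma deviation_third_moment (D : torder V -> {set bool * 'I_N}) : (0 < N)%N ->
  (forall r, down_closed (lt r) (D r)) ->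
  \sum_r mu r * `|deviation sgn (D r)| ^+ 3 <= 60 * N%:R ^+ 2.
Proof.
move=> N0 D_down.
have ptw r : `|deviation sgn (D r)| ^+ 3 <=
    6 * \sum_w (deviation sgn (below (lt r) w) ^+ 2 + 1).
  apply: le_trans (deviation_cube _ _ _ sample_sign_norm (D_down r)) _.
  - by move=> x; rewrite /lt tlt_irr.
  - by move=> x y z; apply: tlt_trans.
  - by move=> x y xy; apply: tlt_total; rewrite inj_eq.
  rewrite (_ : 6 = 3 * 2) -?mulrA; last by rewrite -natrM.
  rewrite ler_wpM2l // mulr_sumr.
  apply: (@le_trans _ _ (\sum_(w in D r) 2 * (deviation sgn (below (lt r) w) ^+ 2 + 1))).
    apply: ler_sum => w _; have := sample_sign_sqr w.
    by have := sqr_ge0 (deviation sgn (below (lt r) w) - sgn w); lra.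
  rewrite [leRHS](bigID (mem (D r))) /= lerDl.
  by apply: sumr_ge0 => w _; rewrite mulr_ge0 // addr_ge0 // sqr_ge0.
apply: (@le_trans _ _ (\sum_r mu r * (6 * \sum_w (deviation sgn (below (lt r) w) ^+ 2 + 1)))).
  by apply: ler_sum => r _; rewrite ler_wpM2l ?weight_ge0.
have -> : \sum_r mu r * (6 * \sum_w (deviation sgn (below (lt r) w) ^+ 2 + 1)) =
    6 * \sum_w (\sum_r mu r * deviation sgn (below (lt r) w) ^+ 2 + 1).
  under eq_bigr do rewrite mulrCA mulr_sumr.
  rewrite -mulr_sumr exchange_big; congr (_ * _); apply: eq_bigr => w _ /=.
  by under eq_bigr do rewrite mulrDr mulr1; rewrite big_split weight_sum1.
apply: (@le_trans _ _ (6 * \sum_(w : bool * 'I_N) (5 * N%:R))).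
  rewrite ler_wpM2l //; apply: ler_sum => w _.
  apply: le_trans (lerD (deviation_second_moment w) (lexx _)) _.
  by rewrite -(natrD _ _ 1) -natrM ler_nat; lia.
rewrite sumr_const card_prod card_bool card_ord -[X in _ * X <= _]mulr_natr natrM; lra.
Qed.

(** The elements that fit between [p] and [q] form the difference of two
    down-sets, whose deviations are both small.  The right-hand side is
    [O(eps * N)] for large [N], and [eps] is at choice. *)
Lemma insertion_gap (p q : seq V) (eps : R) : (0 < N)%N -> 0 < eps ->
  (forall j, T j \notin p) ->
  `| \sum_(i < N) prob_chain mu (p ++ T (true, i) :: q) -
     \sum_(i < N) prob_chain mu (p ++ T (false, i) :: q) | <=
  2 * (eps * N%:R + 60 / eps ^+ 2).
Proof.
move=> N0 eps0 Tp.
pose Dlo r := [set j | has (tlt r (T j)) p].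
pose Dhi r := [set j | all (tlt r (T j)) q].
have Dlo_down r : down_closed (lt r) (Dlo r).
  move=> i j ij; rewrite !inE => /hasP[x xp jx]; apply/hasP; exists x => //.
  exact: tlt_trans jx.
have Dhi_down r : down_closed (lt r) (Dhi r).
  move=> i j ij; rewrite !inE => /allP jq; apply/allP => x /jq; exact: tlt_trans.
pose gap r : R := (sorted (tlt r) (p ++ q))%:R *
  (deviation sgn (Dhi r) - deviation sgn (Dlo r)).
have -> : \sum_(i < N) prob_chain mu (p ++ T (true, i) :: q) -
    \sum_(i < N) prob_chain mu (p ++ T (false, i) :: q) = \sum_r mu r * gap r.
  transitivity (\sum_j sgn j * prob_chain mu (p ++ T j :: q)).
    pose F b i := sgn (b, i) * prob_chain mu (p ++ T (b, i) :: q).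
    rewrite [RHS](eq_bigr (fun j => F j.1 j.2)) -?[RHS](pair_bigA _ F); last by case.
    rewrite big_bool /F /sgn /= -sumrN; congr (_ + _); apply: eq_bigr => i _.
      by rewrite mul1r.
    by rewrite mulN1r.
  under eq_bigr do rewrite prob_chainE mulr_sumr.
  rewrite exchange_big; apply: eq_bigr => r _ /=.
  under eq_bigr do rewrite mulrCA.
  rewrite -mulr_sumr; congr (_ * _); rewrite /gap.
  under eq_bigr do rewrite sorted_insert //.
  case: (boolP (sorted _ _)) => [pq_sorted|_] /=; last first.
    by rewrite mul0r; apply: big1 => j _; rewrite mulr0.
  rewrite mul1r.
  have lo_hi : Dlo r \subset Dhi r.
    apply/subsetP => j; rewrite !inE => /hasP[x xp jx]; apply/allP => y yq.
    apply: tlt_trans jx _; move: pq_sorted.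
    by rewrite (sorted_pairwise (@tlt_trans _ r)) pairwise_cat => /andP[/allrelP/(_ x y xp yq)].
  rewrite /deviation [X in _ = X - _](big_setID (Dlo r)) /= (setIidPr lo_hi).
  rewrite addrAC subrr add0r [RHS]big_mkcond /=; apply: eq_bigr => j _.
  by rewrite !inE; case: ifP; rewrite ?mulr1 ?mulr0.
have E_bound (D : torder V -> {set bool * 'I_N}) : (forall r, down_closed (lt r) (D r)) ->
    \sum_r mu r * `|deviation sgn (D r)| <= eps * N%:R + 60 / eps ^+ 2.
  move=> /(deviation_third_moment N0) bound.
  have N0' : 0 < N%:R :> R by rewrite ltr0n.
  (* below the threshold [d] a deviation is harmless, above it the third moment
     takes over *)
  set d := eps * N%:R; have d0 : 0 < d by rewrite mulr_gt0.
  have cube (a : R) : 0 <= a -> a <= d + a ^+ 3 / d ^+ 2.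
    move=> a0; case: (lerP a d) => [ad|da].
      by rewrite ler_wpDr // divr_ge0 ?exprn_ge0 // ltW.
    rewrite ler_wpDl ?(ltW d0) // ler_pdivlMr ?exprn_gt0 // [a ^+ 3]exprS ler_wpM2l //.
    by rewrite lerXn2r ?nnegrE // ltW.
  apply: (@le_trans _ _ (\sum_r mu r * (d + `|deviation sgn (D r)| ^+ 3 / d ^+ 2))).
    by apply: ler_sum => r _; rewrite ler_wpM2l ?weight_ge0 ?cube.
  under eq_bigr do rewrite mulrDr [X in _ + X]mulrA.
  rewrite big_split /= -!mulr_suml weight_sum1 mul1r lerD2l.
  rewrite ler_pdivrMr ?exprn_gt0 // /d exprMn mulrA divfK ?gt_eqF ?exprn_gt0 //.
apply: le_trans (ler_norm_sum _ _ _) _.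
apply: (@le_trans _ _ (\sum_r (mu r * `|deviation sgn (Dhi r)| +
                              mu r * `|deviation sgn (Dlo r)|))).
  apply: ler_sum => r _; rewrite normrM ger0_norm ?weight_ge0 // -mulrDr.
  rewrite ler_wpM2l ?weight_ge0 // /gap normrM normr_nat.
  apply: le_trans (ler_normB _ _); rewrite ler_piMl //.
  by rewrite lern1 leq_b1.
by rewrite big_split /= mulr_natl mulr2n lerD ?E_bound.
Qed.

End TwoSamples.

(** * Rewiring one vertex *)

Section Rewire.
Variables (G K : sgraph) (iota : G -> K) (u : G) (w : K).

Definition rewire : sgraph := pullback (fun x => if x == u then w else iota x).

(** Arbitrarily many twins of [iota u] and of [w] can be added to [G] at once
    inside [P]; [pi] tells which vertex of [K] each vertex is a twin of. *)
Definition twin_samples (P : sgraph -> Prop) : Prop :=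
  forall N, exists (H : sgraph) (pi : H -> K) (h : G -> H) (T : bool * 'I_N -> H),
    [/\ P H, full_map pi & injective T] /\
    [/\ forall x, pi (h x) = iota x,
        forall j, pi (T j) = if j.1 then iota u else w
      & forall j x, T j != h x].

End Rewire.

Section RewireChain.
Variables (R : realType) (P : sgraph -> Prop) (M : ordering_model R P).
Hypotheses (P_iso : iso_closed P) (P_hereditary : hereditary P).
Hypothesis M_cons : consistent M.
Variables (G K : sgraph) (iota : G -> K) (u : G) (w : K).
Hypothesis iota_emb : embedding iota.
Hypothesis samples : twin_samples iota u w P.

Lemma rewire_insertion N :
  exists (H : sgraph) (pi : H -> K) (h : G -> H) (T : bool * 'I_N -> H),
  [/\ P H, full_map pi, injective T & forall j, pi (T j) = if j.1 then iota u else w] /\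
  [/\ forall j x, T j != h x,
      forall i, @embedding G H (fun x => if x == u then T (true, i) else h x)
    & forall i, @embedding (rewire iota u w) H
        (fun x => if x == u then T (false, i) else h x)].
Proof.
have [H [pi [h [T [[PH pi_full T_inj] [pi_h pi_T Th]]]]]] := samples N.
have f_inj j : injective (fun x => if x == u then T j else h x).
  move=> x y; case: eqP => [->|_]; case: eqP => [->|_] // e.
  - by have := Th j y; rewrite e eqxx.
  - by have := Th j x; rewrite -e eqxx.
  - by have := congr1 pi e; rewrite !pi_h; apply: iota_emb.1.
have pi_f j x : pi (if x == u then T j else h x) =
    if x == u then (if j.1 then iota u else w) else iota x.
  by case: ifP => _; rewrite ?pi_T ?pi_h.
exists H, pi, h, T; split=> //; split=> // i; split; try exact: f_inj.
  move=> x y; rewrite -pi_full !pi_f /= -iota_emb.2.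
  by case: eqP => [->|_]; case: eqP => [->|_].
by move=> x y; rewrite -pi_full !pi_f.
Qed.

Lemma rewire_closed : P (rewire iota u w).
Proof.
have [H [_ [h [T [[PH _ _ _] [_ _ /(_ ord0) emb]]]]]] := rewire_insertion 1.
exact: embedding_closed emb PH.
Qed.

Hypothesis uw_edge : edge (iota u) w = false.

(** The twins of [iota u] and of [w] together are pairwise non-adjacent, hence
    exchangeable; averaging over either sample turns the difference into an
    insertion gap. *)
Lemma rewire_chain (hG : P G) (hG' : P (rewire iota u w)) (xs : seq G) :
  uniq xs -> prob_chain (M hG) xs = prob_chain (M hG') xs.
Proof.
move=> xs_uniq; apply/eqP; rewrite -subr_eq0 -normr_eq0; apply: contraT => nz.
set D := `|_| in nz; have D0 : 0 < D by rewrite lt_neqAle eq_sym nz normr_ge0.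
(* The gap [N * D] would be at most [2 * eps * N + 120 / eps ^ 2]: with this
   [eps] the first term is half of it, with this [N] the second is less. *)
pose eps := D / 4; have eps0 : 0 < eps by rewrite divr_gt0.
pose N := (Num.bound (240 / eps ^+ 2 / D)).+2.
have [H [pi [h [T [[hH pi_full T_inj pi_T] [Th emb emb']]]]]] := rewire_insertion N.
have T_edge i j : edge (T i) (T j) = false.
  by rewrite -pi_full !pi_T; case: i.1; case: j.1;
    rewrite ?edge_irr // edge_sym.
have N0 : (0 < N)%N by [].
pose ord1 : 'I_N := Ordinal (isT : (1 < N)%N).
pose c := prob_chain (M hH) [:: T (true, ord0); T (true, ord1); T (false, ord0)].
have c01 : 0 <= c <= 1 by rewrite prob_chain_ge0 prob_chain_le1.
have triples t s z : uniq [:: t; s; z] -> prob_chain (M hH) [:: T t; T s; T z] = c.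
  move=> tsz; pose pick (l : seq (bool * 'I_N)) (i : 'I_3) := T (nth t l i).
  have pick_inj l : size l = 3 -> uniq l -> injective (pick l).
    move=> l3 ul i j /T_inj/eqP; rewrite nth_uniq ?l3 // => /eqP; exact: val_inj.
  pose l0 : seq (bool * 'I_N) := [:: (true, ord0); (true, ord1); (false, ord0)].
  have := @congruent_chain P P_iso P_hereditary R M M_cons 'I_3 H hH
    (pick [:: t; s; z]) (pick l0) [:: 0; 1; 2%:R].
  apply; [exact: pick_inj|exact: pick_inj|].
  by move=> x y; rewrite !T_edge.
have chainG i : prob_chain (M hG) xs =
    prob_chain (M hH) [seq if x == u then T (true, i) else h x | x <- xs].
  by rewrite (embedding_chain M_cons hG hH _ (emb i)).
have chainG' i : prob_chain (M hG') xs =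
    prob_chain (M hH) [seq if x == u then T (false, i) else h x | x <- xs].
  by rewrite (embedding_chain M_cons hG' hH _ (emb' i)).
case: (boolP (u \in xs)) => [uxs|uxs]; last first.
  have noT j : [seq if x == u then T j else h x | x <- xs] = map h xs.
    by apply/eq_in_map => x xin; case: eqP xin uxs => // -> ->.
  by move: nz; rewrite /D (chainG ord0) (chainG' ord0) !noT subrr normr0 eqxx.
have [p [q [Tp fE]]] : exists p q : seq H, (forall j, T j \notin p) /\
    forall j, [seq if x == u then T j else h x | x <- xs] = p ++ T j :: q.
  have [l [r xsE]] : exists l r, xs = l ++ u :: r.
    by case/splitPr: uxs => l r; exists l, r.
  move: xs_uniq; rewrite xsE cat_uniq /= => /and3P[_ /norP[ul _] /andP[ur _]].
  exists (map h l), (map h r); split=> j.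
    by apply/mapP => -[x _ /eqP]; apply/negP.
  rewrite map_cat /= eqxx; congr (_ ++ _ :: _); apply/eq_in_map => x xin.
    by case: eqP xin ul => // -> ->.
  by case: eqP xin ur => // -> ->.
have := insertion_gap T_inj triples c01 q N0 eps0 Tp.
under eq_bigr do rewrite -fE -chainG.
under [X in _ - X]eq_bigr do rewrite -fE -chainG'.
rewrite !sumr_const card_ord -mulrnBl normrMn -/D -[_ *+ _]mulr_natl => gap.
have : 240 / eps ^+ 2 / D < N%:R.
  apply: lt_trans (archi_boundP _) _; last by rewrite ltr_nat.
  by rewrite !divr_ge0 ?exprn_ge0 // ltW.
rewrite ltr_pdivrMr // => big.
have epsD : D = 4 * eps by rewrite /eps; lra.
have split_eps : 240 / eps ^+ 2 = 4 * (60 / eps ^+ 2) by lra.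
move: gap big; rewrite {}split_eps epsD; move: (60 / _) (N%:R) => a n.
by nra.
Qed.

End RewireChain.

(** * A concave sum over the degrees *)

Local Open Scope nat_scope.

Definition rest_degree (G : sgraph) (u x : G) : nat :=
  #|[set y : G | (y != u) && edge x y]|.

Lemma degree_rest (G : sgraph) (u x : G) :
  degree x = edge x u + rest_degree u x.
Proof.
rewrite /degree (cardsD1 u) inE; congr (_ + _).
by apply: eq_card => y; rewrite !inE.
Qed.

Lemma degree_lt_card (G : sgraph) (x : G) : degree x < #|G|.
Proof.
rewrite /degree -cardsT; apply/proper_card/properP; split; first exact: subsetT.
by exists x; rewrite !inE ?edge_irr.
Qed.

(** A strictly increasing and strictly concave function of the degree: the sum
    drops when a leaf is cut off, and also when it is moved from one vertex to
    another of at least the same degree. *)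
Definition degree_energy (G : sgraph) : nat :=
  \sum_(x : G) degree x * (2 * #|G| - degree x).

Lemma leaf_edge (G : sgraph) (u v : G) : is_leaf u -> edge u v ->
  forall x, edge x u = (x == v).
Proof.
move=> /cards1P[v' Nu] uv x; rewrite edge_sym.
have NuE y : edge u y = (y == v') by have := in_set1 y v'; rewrite -Nu inE.
by move: uv; rewrite !NuE => /eqP ->.
Qed.

Section Measure.
Variables (G K : sgraph) (iota : G -> K) (u : G) (w : K).
Hypothesis iota_full : full_map iota.

Lemma rewire_degree (x : G) : x != u ->
  @degree (rewire iota u w) x = edge (iota x) w + rest_degree u x.
Proof.
move=> xu; apply: etrans (@degree_rest (rewire iota u w) u x) _.
rewrite /= /pullback_edge (negbTE xu) eqxx.
congr (_ + _); apply: eq_card => y; rewrite !inE /= /pullback_edge (negbTE xu).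
by case: eqP => // _; rewrite iota_full.
Qed.

Lemma rewire_degree_self :
  @degree (rewire iota u w) u = #|[set y : G | (y != u) && edge w (iota y)]|.
Proof.
apply: eq_card => y; rewrite !inE /= /pullback_edge eqxx.
by case: eqP => //= _; rewrite edge_irr.
Qed.

Lemma isolate_energy : is_leaf u -> (forall y, edge w y = false) ->
  degree_energy (rewire iota u w) < degree_energy G.
Proof.
move=> u_leaf w_iso; rewrite /degree_energy.
rewrite (bigD1 u) //= [X in _ < X](bigD1 u) //= (eqP u_leaf).
have -> : @degree (rewire iota u w) u = 0.
  by rewrite rewire_degree_self; apply: eq_card0 => y; rewrite !inE w_iso andbF.
have le : \sum_(x : G | x != u) @degree (rewire iota u w) x *
      (2 * #|G| - @degree (rewire iota u w) x) <=
    \sum_(x : G | x != u) degree x * (2 * #|G| - degree x).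
  apply: leq_sum => x xu; rewrite rewire_degree // edge_sym w_iso.
  by have := degree_lt_card x; rewrite (degree_rest u x); case: edge; nia.
rewrite mul0n add0n; apply: leq_ltn_trans le _; rewrite -[ltnLHS]add0n ltn_add2r.
by have := degree_lt_card u; rewrite (eqP u_leaf); move: #|_| => n; lia.
Qed.

End Measure.

Lemma move_energy (G : sgraph) (u1 u2 v1 v2 : G) :
  is_leaf u1 -> is_leaf u2 -> edge u1 v1 -> edge u2 v2 -> v1 != v2 ->
  edge u1 u2 = false -> degree v1 <= degree v2 ->
  degree_energy (rewire id u1 u2) < degree_energy G.
Proof.
move=> leaf1 leaf2 e1 e2 v12 u12 deg_le.
have edge1 := leaf_edge leaf1 e1; have edge2 := leaf_edge leaf2 e2.
have v1u1 : v1 != u1 by apply: contraTneq e1 => ->; rewrite edge_irr.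
have v2u1 : v2 != u1 by apply: contraTneq e2 => ->; rewrite edge_sym u12.
have full : full_map (@id G) by [].
have deg' x : x != u1 -> @degree (rewire id u1 u2) x = (x == v2) + rest_degree u1 x.
  by move=> xu; rewrite (rewire_degree _ full) // edge2.
have deg x : degree x = (x == v1) + rest_degree u1 x.
  by rewrite (degree_rest u1) edge1.
have deg_u1 : @degree (rewire id u1 u2) u1 = degree u1.
  rewrite rewire_degree_self (eqP leaf1) -(eqP leaf2).
  by apply: eq_card => y; rewrite !inE; case: eqP => // ->; rewrite edge_sym u12.
rewrite /degree_energy (bigD1 u1) //= [X in _ < X](bigD1 u1) //= deg_u1 ltn_add2l.
rewrite (bigD1 v1) //= [X in _ < X](bigD1 v1) //=.
have v2P : (v2 != u1) && (v2 != v1) by rewrite v2u1 eq_sym.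
rewrite (bigD1 v2) //= [X in _ < _ + X](bigD1 v2) //=.
rewrite (eq_bigr (fun x => degree x * (2 * #|G| - degree x))); last first.
  move=> x /andP[/andP[xu xv1] xv2].
  by rewrite deg' // deg (negbTE xv1) (negbTE xv2).
rewrite !addnA ltn_add2r !deg' // !deg !eqxx (negbTE v12) [v2 == v1]eq_sym (negbTE v12).
have := degree_lt_card v2; have := degree_lt_card v1.
have := @degree_lt_card (rewire id u1 u2) v2.
move: deg_le; rewrite deg' // !deg !eqxx [v2 == v1]eq_sym (negbTE v12) /=.
move: (rest_degree _ _) (rest_degree _ _) (#|_|) => a b n; nia.
Qed.

(** * The two leaf conditions *)

Lemma lift_ord_max_neq n (i : 'I_n) : lift ord_max i != ord_max.
Proof. by rewrite eq_sym neq_lift. Qed.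

Section LeafConditions.
Variables (P : sgraph -> Prop) (G : sgraph).

(** One more twin is taken than the sample needs: the last one, [ord_max],
    stands for the leaf itself. *)
Lemma one_leaf_samples : one_leaf_condition P G ->
  exists2 u : G, is_leaf u &
    @twin_samples G (add_isolated G 1) inl u (inr ord0) P.
Proof.
move=> [u [u_leaf PH]]; exists u => // N.
pose H := add_isolated (replace_by_twins u N.+1) N.
pose pi (a : H) : add_isolated G 1 :=
  match a with
  | inl (inl x) => inl (val x)
  | inl (inr _) => inl u
  | inr _ => inr ord0
  end.
pose T (j : bool * 'I_N) : H :=
  if j.1 then inl (inr (lift ord_max j.2)) else inr j.2.
have /fin_all_exists[h hP] : forall x : G, exists a : H,
    pi a = inl x /\ forall j, T j != a.
  move=> x; case: (eqVneq x u) => [->|xu].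
    exists (inl (inr ord_max)); split=> // -[[] i] //=.
    exact: lift_ord_max_neq.
  by exists (inl (inl (exist _ x xu))); split=> // -[[] i].
exists H, pi, h, T; split; split=> //; first exact: PH.
- by move=> [[x|i]|i] [[y|j]|j] //=; rewrite edge_irr.
- move=> [[] i] [[] j] //= /eqP e; last by move/eqP: e => -[->].
  by rewrite (lift_inj (eqP (e : lift ord_max i == lift ord_max j))).
- by move=> x; case: (hP x).
- by move=> [[] i].
- by move=> j x; case: (hP x).
Qed.

Lemma two_leaves_samples : two_leaves_condition P G ->
  exists u1 u2 v1 v2 : G,
    [/\ is_leaf u1, is_leaf u2, edge u1 v1, edge u2 v2 & v1 != v2] /\
    twin_samples id u1 u2 P.
Proof.
move=> [u1 [u2 [v1 [v2 [u21 [leaves PH]]]]]]; exists u1, u2, v1, v2; split=> // N.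
have := PH N.+1 N.+1.
set K := replace_by_twins u1 N.+1; set u2' : K := inl _.
pose H := replace_by_twins u2' N.+1 => PH'.
pose pi (a : H) : G :=
  match a with
  | inl y => match val y with inl x => val x | inr _ => u1 end
  | inr _ => u2
  end.
pose T (j : bool * 'I_N) : H :=
  if j.1 then inl (exist _ (inr (lift ord_max j.2) : K) (isT : inr _ != u2'))
  else inr (lift ord_max j.2).
have /fin_all_exists[h hP] : forall x : G, exists a : H,
    pi a = x /\ forall j, T j != a.
  move=> x; case: (eqVneq x u1) => [->|xu1].
    exists (inl (exist _ (inr ord_max : K) (isT : inr _ != u2'))); split=> // -[[] i] //=.
    exact: lift_ord_max_neq.
  case: (eqVneq x u2) => [->|xu2].
    exists (inr ord_max); split=> // -[[] i] //=.
    exact: lift_ord_max_neq.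
  have xP : (inl (exist _ x xu1) : K) != u2' by apply: contra_neq xu2 => -[].
  by exists (inl (exist (fun y : K => y != u2') _ xP)); split=> // -[[] i].
exists H, pi, h, T; split; split=> //.
- move=> [[[x|i] xP]|i] [[[y|j] yP]|j] //=; exact: edge_irr.
- move=> [[] i] [[] j] //= /eqP e;
    by rewrite (lift_inj (eqP (e : lift ord_max i == lift ord_max j))).
- by move=> x; case: (hP x).
- by move=> [[] i].
- by move=> j x; case: (hP x).
Qed.

Lemma twin_samples_sym (u1 u2 : G) :
  twin_samples id u1 u2 P -> twin_samples id u2 u1 P.
Proof.
move=> samples N; have [H [pi [h [T [[PH pi_full T_inj] [pi_h pi_T Th]]]]]] := samples N.
exists H, pi, h, (fun j => T (~~ j.1, j.2)); split; split=> //.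
  by move=> [b i] [c j] /T_inj[/negb_inj -> ->].
by move=> j; rewrite pi_T /= if_neg.
Qed.

(** Two adjacent vertices both replaced by two twins span a four-cycle. *)
Lemma twin_samples_nonadjacent (u1 u2 : G) :
  (forall F, P F -> is_forest F) -> twin_samples id u1 u2 P ->
  edge u1 u2 = false.
Proof.
move=> P_forest samples; apply/negbTE/negP => u12.
have u21 : edge u2 u1 by rewrite edge_sym.
have [H [pi [h [T [[PH pi_full T_inj] [pi_h pi_T Th]]]]]] := samples 2.
apply: (P_forest H PH); pose i1 : 'I_2 := lift ord0 ord0.
exists [:: T (true, ord0); T (false, ord0); T (true, i1); T (false, i1)]; split => //.
  by rewrite /= !inE !(inj_eq T_inj).
by rewrite /= -!pi_full !pi_T /= u12 u21.
Qed.

End LeafConditions.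

(** * Uniformity *)

Local Open Scope ring_scope.

Section Uniformity.
Variables (R : realType) (P : sgraph -> Prop) (M : ordering_model R P).
Hypotheses (P_iso : iso_closed P) (P_hereditary : hereditary P).
Hypothesis M_cons : consistent M.

Lemma rewire_uniform (G K : sgraph) (iota : G -> K) (u : G) (w : K) :
  embedding iota -> twin_samples iota u w P -> edge (iota u) w = false ->
  (forall hG' : P (rewire iota u w), M hG' =1 uniform_model R hG') ->
  forall hG : P G, M hG =1 uniform_model R hG.
Proof.
move=> iota_emb samples uw IH hG r.
have hG' := rewire_closed P_iso P_hereditary iota_emb samples.
have [xs xs_perm xs_r] := exists_enum_chain r.
have full x : x \in xs by rewrite (perm_mem xs_perm) mem_enum.
rewrite (weight_chain (M hG) full xs_r).
rewrite (rewire_chain P_iso P_hereditary M_cons iota_emb samples uw hG hG').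
  by rewrite -(weight_chain (M hG') full xs_r) IH /uniform_model /= !ffunE.
by rewrite (perm_uniq xs_perm) enum_uniq.
Qed.

End Uniformity.

Theorem theorem1p8 (R : realType) (P : sgraph -> Prop)
    (P_iso : iso_closed P) (P_hereditary : hereditary P)
    (P_forest : forall F : sgraph, P F -> is_forest F)
    (P_leaves : forall F : sgraph, P F -> nonempty_graph F ->
       one_leaf_condition P F \/ two_leaves_condition P F) :
  uniform_property R P.
Proof.
split; first exact: uniform_consistent.
move=> M M_cons G.
elim: {G}_.+1 {-2}G (ltnSn (degree_energy G)) => // n IHn G; rewrite ltnS => Gn hG.
case: (boolP [exists x : G, exists y : G, edge x y]) => [|G0]; last first.
  apply: (edgeless_uniform P_iso P_hereditary M_cons) => -[x [y xy]].
  by case/existsP: G0; exists x; apply/existsP; exists y.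
move=> /existsP[x0 /existsP[y0 xy0]]; have G_edge : nonempty_graph G by exists x0, y0.
have step (K : sgraph) (iota : G -> K) u w : embedding iota -> twin_samples iota u w P ->
    edge (iota u) w = false ->
    (degree_energy (rewire iota u w) < degree_energy G)%N ->
    M G hG =1 uniform_model R hG.
  move=> iota_emb samples uw lt.
  apply: (rewire_uniform P_iso P_hereditary M_cons iota_emb samples uw) => hG'.
  by apply: IHn; apply: leq_trans lt Gn.
have [one|two] := P_leaves G hG G_edge.
  have [u u_leaf samples] := one_leaf_samples one.
  apply: (step _ _ u _ _ samples) => //; first by split=> // x y [].
  by apply: isolate_energy => // -[].
have [u1 [u2 [v1 [v2 [[l1 l2 e1 e2 v12] samples]]]]] := two_leaves_samples two.
have u12 := twin_samples_nonadjacent P_forest samples.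
have id_emb : embedding (@id G) by split.
have [le|/ltnW le] := leqP (degree v1) (degree v2).
  apply: (step _ _ u1 u2 id_emb samples u12).
  exact: move_energy l1 l2 e1 e2 v12 u12 le.
have u21 : edge u2 u1 = false by rewrite edge_sym.
apply: (step _ _ u2 u1 id_emb (twin_samples_sym samples) u21).
by apply: move_energy l2 l1 e2 e1 _ u21 le; rewrite eq_sym.
Qed.
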